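(* Let $\mathbb{F}\in\{\mathbb{R},\mathbb{C}\}$, let $(X,\Sigma,P)$ be a probability space, and let $\mathcal{H}\subseteq\mathbb{F}^X$ be a separable reproducing kernel Hilbert space whose reproducing kernel $K\colon X\times X\to\mathbb{F}$ is measurable. For each sequence $x=(x_i)_i\in X^{\mathbb{N}}$ and each $n\in\mathbb{N}$, let $\pi^n_x$ denote the orthogonal projection of $\mathcal{H}$ onto $\operatorname{span}\{K_{x_i}\}_{i=1}^n$ (which depends only on $x_1,\dots,x_n$). Let $f\in\mathcal{H}$ and, for each $\delta>0$ and $n\in\mathbb{N}$, define $$B_{n,\delta}:=\{(x_1,\ldots,x_n)\in X^n\mid \|f-\pi^n_x f\|_{\mathcal{H}}\ge\delta\}.$$ Then, for each $\delta>0$, $$\limsup_{n\to\infty}P^n(B_{n,\delta})\le\frac{1}{\delta^2}\,d_{\mathcal{H}}(f,\mathcal{H}_P)^2,$$ where $d_{\mathcal{H}}(f,\mathcal{H}_P)=\inf_{g\in\mathcal{H}_P}\|f-g\|_{\mathcal{H}}$ and $P^n$ is the product probability measure on $X^n$. In particular, if $f$ belongs to the closure of $\mathcal{H}_P$ in $\mathcal{H}$, then $$\lim_{n\to\infty}P^n(B_{n,\delta})=0.$$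
   Context: A Hilbert space $\mathcal{H}\subseteq\mathbb{F}^X$ of functions on $X$ is a reproducing kernel Hilbert space (RKHS) with reproducing kernel $K$ if, writing $K_p:=K(\cdot,p)$, one has $K_p\in\mathcal{H}$ and $f(p)=\langle f,K_p\rangle$ for all $p\in X$ and $f\in\mathcal{H}$. Measurability of $K$ is with respect to the product $\sigma$-algebra $\Sigma\otimes\Sigma$. $P_K$ is the measure on $(X,\Sigma)$ defined by $dP_K(x)=K(x,x)\,dP(x)$. The operator $L_{P,K}\colon L^2(X;P_K)\to\mathcal{H}$ is the bounded linear operator $L_{P,K}\lambda:=\int_X\lambda(x)K_x\,dP(x)$, a Bochner integral in $\mathcal{H}$ (it exists for every $\lambda\in L^2(X;P_K)$). $\mathcal{H}_P:=L_{P,K}(L^2(X;P_K))\subseteq\mathcal{H}$ is its range. *)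

(* Defs.v *)
From HB Require Import structures.
From mathcomp Require Import all_boot all_order all_algebra.
From mathcomp Require Import complex.
From mathcomp Require Import all_classical all_reals all_analysis.

Set Implicit Arguments.
Unset Strict Implicit.
Unset Printing Implicit Defensive.

Import Order.TTheory GRing.Theory Num.Theory.
Import numFieldNormedType.Exports.

Local Open Scope classical_set_scope.
Local Open Scope ring_scope.

Variant field_kind := RealScalars | ComplexScalars.

Definition base_field (R : realType) (k : field_kind) : numFieldType :=
  match k with RealScalars => R | ComplexScalars => R[i] end.

Section scalars.
Context {R : realType} {k : field_kind}.
Local Notation F := (base_field R k).

Definition sconj : F -> F :=
  match k return base_field R k -> base_field R k with
  | RealScalars => fun x => x
  | ComplexScalars => fun x : R[i] => conjc x
  end.

Definition sre : F -> R :=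
  match k return base_field R k -> R with
  | RealScalars => fun x => x
  | ComplexScalars => fun x : R[i] => complex.Re x
  end.

Definition sreal : R -> F :=
  match k return R -> base_field R k with
  | RealScalars => fun x => x
  | ComplexScalars => fun x => (x%:C)%C
  end.

Lemma sconj_is_zmod_morphism : zmod_morphism sconj.
Proof. by rewrite /sconj; case: k => // x y; exact: rmorphB. Qed.

Lemma sconj_is_monoid_morphism : monoid_morphism sconj.
Proof.
rewrite /sconj; case: k; first by split.
by split => [|x y]; [exact: rmorph1|exact: rmorphM].
Qed.

Lemma sconjK : involutive sconj.
Proof. by rewrite /sconj; case: k => // x; exact: conjcK. Qed.

HB.instance Definition _ :=
  GRing.isZmodMorphism.Build F F sconj sconj_is_zmod_morphism.
HB.instance Definition _ :=
  GRing.isMonoidMorphism.Build F F sconj sconj_is_monoid_morphism.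
HB.instance Definition _ := isInvolutive.Build F sconj sconjK.

(* The norm of a normed module over F takes its values in F; rnorm is the same
   quantity as an element of R. *)
Definition rnorm (V : normedModType F) (v : V) : R := sre `|v|.

Definition dist_to (V : normedModType F) (f : V) (A : set V) : R :=
  inf [set rnorm (f - g) | g in A].

End scalars.

Definition borel_measurable d (X : measurableType d) (T : topologicalType)
    (f : X -> T) : Prop :=
  forall U : set T, open U -> measurable (f @^-1` U).

Section hilbert.
Context {R : realType} {k : field_kind}.
Local Notation F := (base_field R k).
Context {H : completeNormedModType F}.

Definition hilbert_product (ip : {dot H for @sconj R k}) : Prop :=
  forall u : H, `|u| ^+ 2 = ip u u.

Definition separable : Prop := exists2 S : set H, countable S & dense S.

Definition lin_span n (v : 'I_n -> H) : set H :=
  [set \sum_(i < n) c i *: v i | c in [set: 'I_n -> F]].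

(* Meaningful when f has an orthogonal projection on V, e.g. when V is a closed
   subspace and ip is the inner product of the Hilbert space H. *)
Definition orth_proj (ip : {dot H for @sconj R k}) (V : set H) (f : H) : H :=
  xget 0 [set g | V g /\ forall v, V v -> ip (f - g) v = 0].

(* Elements of H are functions on X through the evaluation map ev, which
   identifies H with a linear subspace of F^X; ksec p is the element of H whose
   underlying function is K(., p). *)
Record reproducing_kernel (X : Type) (ip : {dot H for @sconj R k})
    (ev : H -> X -> F) (K : X -> X -> F) (ksec : X -> H) : Prop := {
  ev_scalar : forall p, scalar (ev ^~ p) ;
  ev_inj : injective ev ;
  ev_ksec : forall p, ev (ksec p) = K ^~ p ;
  reproducing : forall f p, ev f p = ip f (ksec p) }.

End hilbert.
Arguments separable {R k} H.

Section bochner.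
Context {R : realType} {k : field_kind}.
Local Notation F := (base_field R k).
Context {H : completeNormedModType F}.
Context d (X : measurableType d) (P : probability X R).

Definition simple_fun (s : X -> H) : Prop :=
  finite_set (range s) /\ forall v, measurable (s @^-1` [set v]).

Definition simple_integral (s : X -> H) : H :=
  \sum_(v \in range s) sreal (fine (P (s @^-1` [set v]))) *: v.

Definition is_bochner_integral (h : X -> H) (I : H) : Prop :=
  exists s : nat -> X -> H,
    [/\ forall n, simple_fun (s n),
        {ae P, forall x, s n x @[n --> \oo] --> h x},
        (\int[P]_x (rnorm (h x - s n x))%:E)%E @[n --> \oo] --> 0%E
      & simple_integral (s n) @[n --> \oo] --> I].

Definition bochner_integral (h : X -> H) : H :=
  xget 0 (is_bochner_integral h).

End bochner.

Section kernel_operator.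
Context {R : realType} {k : field_kind}.
Local Notation F := (base_field R k).
Context {H : completeNormedModType F}.
Context d (X : measurableType d) (P : probability X R).

(* K x x is a nonnegative real number for a reproducing kernel. *)
Definition kernel_measure (K : X -> X -> F) : set X -> \bar R :=
  fun A => (\int[P]_(x in A) (sre (K x x))%:E)%E.

(* Representatives of the elements of L^2(X; mu): the operator below does not
   distinguish kernel_measure-a.e. equal functions. *)
Definition square_integrable (mu : set X -> \bar R) : set (X -> F) :=
  [set l | borel_measurable l /\
           (\int[mu]_x ((sre `|l x|) ^+ 2)%:E < +oo)%E].

Definition kernel_operator (ksec : X -> H) (l : X -> F) : H :=
  bochner_integral P (fun x => l x *: ksec x).

Definition kernel_range (K : X -> X -> F) (ksec : X -> H) : set H :=
  kernel_operator ksec @` square_integrable (kernel_measure K).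

End kernel_operator.

Section product_power.
Context {R : realType} d (X : measurableType d).

Definition cons_pair n (z : X * n.-tuple X) : n.+1.-tuple X :=
  [tuple of z.1 :: z.2].

Lemma measurable_cons_pair n : measurable_fun setT (@cons_pair n).
Proof. exact: measurable_cons. Qed.

HB.instance Definition _ n :=
  isMeasurableFun.Build _ _ _ _ (@cons_pair n) (@measurable_cons_pair n).

Section product_probability.
Context d' (Y : measurableType d') (P : probability X R) (Q : probability Y R).

Definition product_prob : set (X * Y) -> \bar R := (P \x Q)%E.

HB.instance Definition _ := Measure.on product_prob.

Let product_prob_setT : product_prob setT = 1%E.
Proof.
rewrite /product_prob -setXTT product_measure1E//.
by rewrite [X in (X * _)%E]probability_setT [X in (_ * X)%E]probability_setT mule1.
Qed.

HB.instance Definition _ :=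
  Measure_isProbability.Build _ _ _ product_prob product_prob_setT.

End product_probability.

Variable P : probability X R.

Fixpoint prob_power n : probability (n.-tuple X) R :=
  match n with
  | 0 => dirac [tuple]
  | n'.+1 => distribution (product_prob P (prob_power n')) (@cons_pair n')
  end.

Lemma prob_power_box n (A : 'I_n -> set X) : (forall i, measurable (A i)) ->
  prob_power n [set t | forall i, A i (tnth t i)] = (\prod_(i < n) P (A i))%E.
Proof.
elim: n A => [|n IH] A mA /=.
  by rewrite big_ord0 diracE mem_set// => -[].
rewrite /distribution /pushforward /=.
have -> : @cons_pair n @^-1` [set t | forall i, A i (tnth t i)] =
    A ord0 `*` [set t | forall i, A (lift ord0 i) (tnth t i)].
  apply/seteqP; split => -[x t] /=.
    move=> h; split; first by have := h ord0; rewrite tnth0.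
    by move=> i; have := h (lift ord0 i); rewrite tnthS.
  case=> h0 h i; case: (unliftP ord0 i) => [j|] ->; last by rewrite tnth0.
  by rewrite tnthS.
have mB : measurable [set t : n.-tuple X | forall i, A (lift ord0 i) (tnth t i)].
  rewrite [X in measurable X](_ : _ =
      \bigcap_(i in [set: 'I_n]) ((@tnth _ X ^~ i) @^-1` A (lift ord0 i))).
    apply: fin_bigcap_measurable => // i _.
    by rewrite -[X in measurable X]setTI; apply: measurable_tnth.
  by apply/seteqP; split => t /= h i; [move=> _|]; exact: h.
rewrite [LHS]product_measure1E// big_ord_recl; congr (_ * _)%E.
by rewrite -(IH (fun i => A (lift ord0 i))).
Qed.

End product_power.

Section bad_set.
Context {R : realType} {k : field_kind}.
Local Notation F := (base_field R k).
Context {H : completeNormedModType F}.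
Context d (X : measurableType d).

Definition bad_set (ip : {dot H for @sconj R k}) (ksec : X -> H) (f : H)
    (n : nat) (delta : R) : set (n.-tuple X) :=
  [set t | delta <=
    rnorm (f - orth_proj ip (lin_span (fun i => ksec (tnth t i))) f)].

End bad_set.
Arguments bad_set {R k H d X} ip ksec f n delta.

(* Main.v *)
(** Let g = \int l(x) K_x dP(x) be in the range of the operator. The vector
    (1/n) \sum_i l(x_i) K_(x_i) lies in the span of the K_(x_i), so the distance of
    f to that span is at most |f - g| plus the deviation of this empirical mean
    from g. By the weak law of large numbers in H the deviation tends to 0 in
    probability, hence P^n(B_(n,delta)) tends to 0 as soon as |f - g| < delta for
    some g in the range. If there is no such g, then d(f, H_P) >= delta and the
    bound is at least 1.

    The weak law only uses that the Bochner integral is an L^1-limit of simple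
    functions: Chebyshev handles the simple part, Markov the remainder.
    Measurability in H is weak measurability, which for a separable H is inherited
    by norms, by inner products and by Gram-Schmidt residuals. *)

Require Import Defs.
From HB Require Import structures.
From mathcomp Require Import all_boot all_order all_algebra.
From mathcomp Require Import complex.
From mathcomp Require Import all_classical all_reals all_analysis.
From mathcomp Require Import measurable_realfun.
From mathcomp Require Import ring lra.

Set Implicit Arguments.
Unset Strict Implicit.
Unset Printing Implicit Defensive.

Import Order.TTheory GRing.Theory Num.Theory.
Import numFieldNormedType.Exports.

Local Open Scope classical_set_scope.
Local Open Scope ring_scope.

(** * Real and complex scalars treated uniformly *)

Section scalar_theory.
Context {R : realType} {k : field_kind}.
Local Notation F := (base_field R k).
Local Notation sreal := (@sreal R k).
Implicit Types (a b : R) (z w c : F).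

Lemma sre_is_zmod_morphism : zmod_morphism (@sre R k).
Proof. by rewrite /sre; case: k => // -[a b] [a' b']. Qed.

HB.instance Definition _ :=
  GRing.isZmodMorphism.Build F R (@sre R k) sre_is_zmod_morphism.

Lemma sreal_is_zmod_morphism : zmod_morphism sreal.
Proof. by rewrite /sreal; case: k => // x y; exact: rmorphB. Qed.

Lemma sreal_is_monoid_morphism : monoid_morphism sreal.
Proof.
rewrite /sreal; case: k; first by split.
by split => [|x y]; [exact: rmorph1|exact: rmorphM].
Qed.

HB.instance Definition _ :=
  GRing.isZmodMorphism.Build R F sreal sreal_is_zmod_morphism.
HB.instance Definition _ :=
  GRing.isMonoidMorphism.Build R F sreal sreal_is_monoid_morphism.

Lemma sre_real a : sre (sreal a) = a.
Proof. by rewrite /sre /sreal; case: k. Qed.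

Lemma sre_realM a z : sre (sreal a * z) = a * sre z.
Proof. by rewrite /sre /sreal; case: k z => //= -[x y]; rewrite /= mul0r subr0. Qed.

Lemma sre_conj z : sre (sconj z) = sre z.
Proof. by rewrite /sre /sconj; case: k z => [//|[]]. Qed.

Lemma sreal_le a b : (sreal a <= sreal b) = (a <= b).
Proof. by rewrite /sreal; case: k => //=; exact: lecR. Qed.

Lemma sreal_lt a b : (sreal a < sreal b) = (a < b).
Proof. by rewrite /sreal; case: k => //=; exact: ltcR. Qed.

(** The order on complex numbers makes every nonnegative element real; norms and radii in F can
    therefore be replaced by real ones. *)
Lemma sreal_ge0 z : 0 <= z -> z = sreal (sre z).
Proof.
rewrite /sre /sreal; case: k z => //= -[x y] h.
by have /= -> := ger0_Im h.
Qed.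

Lemma sre_norm z : `|z| = sreal (sre `|z|).
Proof. exact/sreal_ge0/normr_ge0. Qed.

Lemma sre_norm_ge0 z : 0 <= sre `|z|.
Proof. by rewrite -sreal_le -sre_norm rmorph0. Qed.

Lemma sre_normM z w : sre `|z * w| = sre `|z| * sre `|w|.
Proof. by rewrite normrM {1}sre_norm sre_realM. Qed.

Lemma normr_sre z : `|sre z| <= sre `|z|.
Proof.
by rewrite /sre; case: k z => //= z; rewrite -lecR (le_trans (normc_ge_Re z))// {1}normc_def.
Qed.

Lemma sre_conjM_ge0 z : sre (sconj z * z) = sre `|z| ^+ 2.
Proof.
rewrite /sre /sconj; case: k z => /= z; first by rewrite -expr2 real_normK// num_real.
case: z => x y /=; rewrite sqr_sqrtr ?addr_ge0 ?sqr_ge0//; ring.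
Qed.

(** Taking for [c] the conjugate of [z] gives the squared modulus. This is how identities in F are
    recovered from real parts alone. *)
Lemma sre_nondeg z : (forall c, sre (c * z) = 0) -> z = 0.
Proof.
move=> /(_ (sconj z)); rewrite sre_conjM_ge0 => /eqP.
rewrite expf_eq0 /= => /eqP z0; apply/eqP.
by rewrite -normr_eq0 sre_norm z0 rmorph0.
Qed.

End scalar_theory.

(** * Hilbert space geometry through the real part of the inner product *)

Section hilbert_theory.
Context {R : realType} {k : field_kind}.
Local Notation F := (base_field R k).
Context {H : completeNormedModType F} {ip : {dot H for @sconj R k}}.
Hypothesis hip : hilbert_product ip.
Implicit Types (u v w : H) (a : R).

Lemma rnorm_sreal v : `|v| = @sreal R k (rnorm v).
Proof. exact/sreal_ge0/normr_ge0. Qed.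

Lemma rnorm_ge0 v : 0 <= rnorm v.
Proof. by rewrite -(@sreal_le _ k) -rnorm_sreal rmorph0. Qed.

Lemma rnorm0 : rnorm (0 : H) = 0.
Proof. by rewrite /rnorm normr0 raddf0. Qed.

Lemma rnorm_eq0 v : rnorm v = 0 -> v = 0.
Proof. by move=> v0; apply/eqP; rewrite -normr_eq0 rnorm_sreal v0 rmorph0. Qed.

Lemma rnormD u v : rnorm (u + v) <= rnorm u + rnorm v.
Proof. by rewrite -(@sreal_le _ k) rmorphD /= -!rnorm_sreal ler_normD. Qed.

Lemma rnormB u v : rnorm (u - v) = rnorm (v - u).
Proof. by rewrite /rnorm distrC. Qed.

Lemma rnorm_tri u v w : rnorm (u - w) <= rnorm (v - w) + rnorm (u - v).
Proof.
by rewrite (_ : u - w = (v - w) + (u - v)) ?rnormD// [RHS]addrC addrA subrK.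
Qed.

Lemma rnormZ a v : rnorm (@sreal R k a *: v) = `|a| * rnorm v.
Proof.
rewrite /rnorm normrZ; have -> : `|@sreal R k a| = sreal `|a|.
  by rewrite /sreal; case: (k) => //; rewrite normc_def /= expr0n addr0 sqrtr_sqr.
by rewrite sre_realM.
Qed.

(** A symmetric real bilinear form with the same norm as [ip], so that estimates become real
    arithmetic over either field. *)
Definition rip u v : R := sre (ip u v).

Lemma ripC u v : rip u v = rip v u.
Proof. by rewrite /rip hermC /= expr0 mul1r sre_conj. Qed.

Lemma rip_sumr u I (s : seq I) (p : pred I) (g : I -> H) :
  rip u (\sum_(i <- s | p i) g i) = \sum_(i <- s | p i) rip u (g i).
Proof. by rewrite /rip linear_sumr raddf_sum. Qed.

Lemma ripDr u v w : rip u (v + w) = rip u v + rip u w.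
Proof. by rewrite /rip linearDr raddfD. Qed.

Lemma ripNr u v : rip u (- v) = - rip u v.
Proof. by rewrite /rip linearNr raddfN. Qed.

Lemma ripBr u v w : rip u (v - w) = rip u v - rip u w.
Proof. by rewrite ripDr ripNr. Qed.

Lemma ripBl u v w : rip (v - w) u = rip v u - rip w u.
Proof. by rewrite ripC ripBr !(ripC u). Qed.

Lemma ripDl u v w : rip (v + w) u = rip v u + rip w u.
Proof. by rewrite ripC ripDr !(ripC u). Qed.

Lemma rip0r u : rip u 0 = 0.
Proof. by rewrite /rip linear0r raddf0. Qed.

Lemma ripZl a u v : rip (@sreal R k a *: u) v = a * rip u v.
Proof. by rewrite /rip linearZl_LR /= sre_realM. Qed.

Lemma ripZr a u v : rip u (@sreal R k a *: v) = a * rip u v.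
Proof. by rewrite ripC ripZl ripC. Qed.

Lemma rip_scale (c : F) u v : rip u (c *: v) = sre (c * ip v u).
Proof. by rewrite ripC /rip linearZl_LR. Qed.

Lemma rip_adj (c : F) u v : rip (c *: u) v = rip u (sconj c *: v).
Proof. by rewrite /rip linearZl_LR linearZr_LR /= sconjK. Qed.

Lemma ripvv u : rip u u = rnorm u ^+ 2.
Proof. by rewrite /rip -hip rnorm_sreal -rmorphXn sre_real. Qed.

Lemma rnormD_sqr u v : rnorm (u + v) ^+ 2 = rnorm u ^+ 2 + 2 * rip u v + rnorm v ^+ 2.
Proof. by rewrite -!ripvv ripDr !ripDl (ripC v u); ring. Qed.

Lemma rnormB_sqr u v : rnorm (u - v) ^+ 2 = rnorm u ^+ 2 - 2 * rip u v + rnorm v ^+ 2.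
Proof. by rewrite -!ripvv ripBr !ripBl (ripC v u); ring. Qed.

Lemma rip_polarization u v : rip u v = (rnorm (u + v) ^+ 2 - rnorm (u - v) ^+ 2) / 4.
Proof. by rewrite rnormD_sqr rnormB_sqr; field. Qed.

(** Cauchy-Schwarz: expand the squared norm of |v| u - |u| v, which is nonnegative, and cancel the
    factor |u| |v|. *)
Lemma rip_le u v : rip u v <= rnorm u * rnorm v.
Proof.
have [->|u0] := eqVneq u 0; first by rewrite rnorm0 mul0r ripC rip0r.
have u_gt0 : 0 < rnorm u.
  by rewrite lt_neqAle rnorm_ge0 andbT eq_sym; apply: contra_neq u0; exact: rnorm_eq0.
have := sqr_ge0 (rnorm (@sreal R k (rnorm v) *: u - @sreal R k (rnorm u) *: v)).
rewrite rnormB_sqr !rnormZ !ger0_norm ?rnorm_ge0// ripZl ripZr => h.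
have [v0|v_gt0] := eqVneq (rnorm v) 0.
  by rewrite (rnorm_eq0 v0) rnorm0 mulr0 rip0r.
have {}v_gt0 : 0 < rnorm v by rewrite lt_neqAle rnorm_ge0 andbT eq_sym.
rewrite -(ler_pM2l u_gt0) -(ler_pM2l v_gt0); nra.
Qed.

Lemma rip_norm_le u v : `|rip u v| <= rnorm u * rnorm v.
Proof.
rewrite ler_norml rip_le andbT lerNl -ripNr (le_trans (rip_le _ _))//.
by rewrite /rnorm normrN.
Qed.

Lemma ip_eq0 u v : (forall c : F, rip (c *: u) v = 0) -> ip u v = 0.
Proof. by move=> h; apply: sre_nondeg => c; rewrite -(h c) /rip linearZl_LR. Qed.

Lemma cvg_rnorm (x : nat -> H) u :
  x n @[n --> \oo] --> u <-> rnorm (x n - u) @[n --> \oo] --> 0.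
Proof.
split=> [xu|xu].
  apply/cvgrPdist_lt => e e0.
  have se0 : 0 < @sreal R k e by rewrite -(rmorph0 (@sreal R k)) sreal_lt.
  move/cvgrPdist_lt : xu => /(_ _ se0).
  apply: filterS => n; rewrite sub0r normrN ger0_norm ?rnorm_ge0//.
  by rewrite distrC rnorm_sreal sreal_lt.
apply/cvgrPdist_lt => e e0.
have ee : e = @sreal R k (sre e) by apply: sreal_ge0; exact: ltW.
have re0 : 0 < sre e by rewrite -(@sreal_lt _ k) rmorph0 -ee.
move/cvgrPdist_lt : xu => /(_ _ re0).
apply: filterS => n; rewrite sub0r normrN ger0_norm ?rnorm_ge0//.
by rewrite distrC rnorm_sreal {2}ee sreal_lt.
Qed.

Lemma cvg_rip (x : nat -> H) u v :
  x n @[n --> \oo] --> u -> rip v (x n) @[n --> \oo] --> rip v u.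
Proof.
move=> /cvg_rnorm xu; apply/cvgrPdist_lt => e e0.
have e1 : 0 < e / (rnorm v + 1) by rewrite divr_gt0// ltr_wpDl ?rnorm_ge0.
move/cvgrPdist_lt : xu => /(_ _ e1); apply: filterS => n.
rewrite sub0r normrN ger0_norm ?rnorm_ge0// distrC -ripBr => h.
rewrite (le_lt_trans (rip_norm_le _ _))//.
move: h; rewrite ltr_pdivlMr ?ltr_wpDl ?rnorm_ge0// => /le_lt_trans; apply.
by rewrite mulrC ler_wpM2l ?rnorm_ge0// lerDl.
Qed.

(* A minimising sequence is Cauchy by the parallelogram identity. *)
Lemma closed_subspace_proj (V : set H) u :
  V 0 -> (forall v w, V v -> V w -> V (v + w)) ->
  (forall a v, V v -> V (@sreal R k a *: v)) -> closed V ->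
  exists2 m, V m & forall v, V v -> rip (u - m) v = 0.
Proof.
move=> V0 VD VZ Vcl.
pose D := [set rnorm (u - v) ^+ 2 | v in V].
have hD : has_inf D.
  split; first by exists (rnorm (u - 0) ^+ 2), 0.
  by exists 0 => _ [v _ <-]; exact: sqr_ge0.
pose dd := inf D.
have ddle v : V v -> dd <= rnorm (u - v) ^+ 2.
  by move=> Vv; apply: ge_inf; [exact: hD.2|exists v].
have /choice[x xP] n : exists v, V v /\ rnorm (u - v) ^+ 2 < dd + n.+1%:R^-1.
  have n0 : 0 < (n.+1%:R : R)^-1 by rewrite invr_gt0.
  by have [_ [v Vv <-] h] := inf_adherent n0 hD; exists v.
(* The midpoint of [x n] and [x p] lies in [V], so its squared distance to [u] is at least [dd]; all
   multiples of [dd] then cancel. *)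
have xD n p : rnorm (x n - x p) ^+ 2 <= 2 * (n.+1%:R^-1 + p.+1%:R^-1).
  have [Vn hn] := xP n; have [Vp hp] := xP p.
  have := ddle (@sreal R k 2^-1 *: (x n + x p)) (VZ _ _ (VD _ _ Vn Vp)).
  have -> : u - @sreal R k 2^-1 *: (x n + x p) =
      @sreal R k 2^-1 *: ((u - x n) + (u - x p)).
    rewrite addrACA -opprD scalerBr; congr (_ - _).
    rewrite -mulr2n -[u *+ 2]scaler_nat scalerA.
    by rewrite -(rmorph_nat (@sreal R k)) -rmorphM mulVf ?rmorph1 ?scale1r// pnatr_eq0.
  rewrite rnormZ exprMn.
  have -> : x n - x p = (u - x p) - (u - x n) by rewrite opprB [RHS]addrC addrA subrK.
  rewrite (rnormB_sqr (u - x p)) (rnormD_sqr (u - x n)) (ripC (u - x p)) normfV ger0_norm//.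
  move: hn hp; move: (_ ^+ 2) (rip _ _) => A C.
  move: (rnorm _ ^+ 2) (n.+1%:R^-1) (p.+1%:R^-1) => B N P.
  by lra.
have xc : cvgn x.
  apply/cauchy_cvgP/cauchy_ballP => e e0.
  have ee : e = @sreal R k (sre e) by apply: sreal_ge0; exact: ltW.
  have re0 : 0 < sre e by rewrite -(@sreal_lt _ k) rmorph0 -ee.
  have e4 : 0 < sre e ^+ 2 / 4 by rewrite divr_gt0// exprn_gt0.
  have [N _ NP] : \forall n \near \oo, (n.+1%:R : R)^-1 < sre e ^+ 2 / 4.
    exact: (near_infty_natSinv_lt (PosNum e4)).
  exists (x @` [set n | (N <= n)%N], x @` [set n | (N <= n)%N]).
    by split; exists N => // n /= Nn; exists n.
  move=> [_ _] [/= [i Ni <-] [j Nj <-]].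
  rewrite -ball_normE /= rnorm_sreal ee sreal_lt.
  rewrite -(ltr_pXn2r (ltn0Sn 1)) ?nnegrE ?rnorm_ge0//; last exact: ltW.
  rewrite (le_lt_trans (xD _ _))//.
  have /= := NP i Ni; have /= := NP j Nj; move: (sre e ^+ 2) => E.
  by move: (i.+1%:R^-1) (j.+1%:R^-1) => a b ? ?; lra.
have Vm : V (limn x).
  by apply: (closed_cvg _ Vcl _ _ xc) => //; apply: nearW => n; case: (xP n).
exists (limn x) => // v Vv.
have hm : rnorm (u - limn x) ^+ 2 <= dd.
  have c1 : rnorm (u - x n) ^+ 2 @[n --> \oo] --> rnorm (u - limn x) ^+ 2.
    have : rnorm (u - x n) @[n --> \oo] --> rnorm (u - limn x).
      apply/cvgrPdist_lt => e e0; have /cvg_rnorm/cvgrPdist_lt/(_ _ e0) := xc.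
      apply: filterS => n; rewrite sub0r normrN ger0_norm ?rnorm_ge0//.
      apply: le_lt_trans; rewrite ler_norml; apply/andP; split.
        rewrite lerNl opprB lerBlDr -(rnormB (limn x)).
        exact: rnorm_tri.
      by rewrite lerBlDr; exact: rnorm_tri.
    by move=> h; exact: (cvgM h h).
  have c2 : dd + n.+1%:R^-1 @[n --> \oo] --> dd.
    rewrite -[X in _ --> X]addr0; apply: cvgD; first exact: cvg_cst.
    exact: cvg_harmonic.
  by apply: ler_cvg_to c1 c2 _; apply: nearW => n; have [_ /ltW] := xP n.
(* First variation: the minimiser is compared with its translate by [t] times [v]. *)
have q t : t * (2 * rip (u - limn x) v) <= t ^+ 2 * rnorm v ^+ 2.
  have := ddle _ (VD _ _ Vm (VZ t _ Vv)).
  rewrite opprD addrA rnormB_sqr ripZr rnormZ exprMn real_normK ?num_real//.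
  by move: hm; lra.
apply/eqP/negPn/negP => ne.
set b := rip _ _ in q ne; set c := rnorm v ^+ 2 in q.
have c0 : 0 <= c by exact: sqr_ge0.
(* The optimal [t] would be [b / c]; adding 1 keeps the denominator positive when [v] is 0, and the
   difference is still negative for nonzero [b]. *)
have := q (b / (c + 1)); rewrite -subr_ge0.
have -> : (b / (c + 1)) ^+ 2 * c - b / (c + 1) * (2 * b) =
  - (b ^+ 2 * (c + 2) / (c + 1) ^+ 2).
  by field; lra.
have b0 : 0 < b ^+ 2 by rewrite lt_neqAle sqr_ge0 eq_sym sqrf_eq0 ne.
rewrite oppr_ge0; apply/negP; rewrite -ltNge divr_gt0//.
  by rewrite mulr_gt0//; lra.
by rewrite exprn_gt0//; lra.
Qed.

End hilbert_theory.
Arguments rip {R k H} ip u v.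

(** * Measurability of real and scalar functions *)

Lemma borel_measurable_fun {R : realType} d (T : measurableType d) (g : T -> R) :
  borel_measurable g -> measurable_fun setT g.
Proof.
move=> mg; apply: (measurability _ (RGenOpens.measurableE R)).
by move=> _ [_ [a [b ->] <-]]; rewrite setTI; apply: mg; exact: interval_open.
Qed.

(** On nonnegative reals, 0 included, inversion is the measurable power function with exponent
    -1. *)
Lemma measurable_funV {R : realType} d (T : measurableType d) (g : T -> R) :
  (forall t, 0 <= g t) -> measurable_fun setT g ->
  measurable_fun setT (fun t => (g t)^-1).
Proof.
move=> g0 mg; under eq_fun do rewrite -powR_inv1//.
  exact: (measurableT_comp (measurable_powR (-1)) mg).
Qed.

Section scalar_measurability.
Context {R : realType} {k : field_kind}.
Local Notation F := (base_field R k).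

(* Borel measurability of a scalar function, expressed through real-valued ones
   uniformly in the base field. *)
Definition scalar_measurable d (T : measurableType d) (a : T -> F) :=
  forall c : F, measurable_fun setT (fun t => sre (c * a t)).

Lemma borel_scalar_measurable d (T : measurableType d) (a : T -> F) :
  borel_measurable a -> scalar_measurable a.
Proof.
move=> ma c; apply: borel_measurable_fun => U oU.
apply: (ma [set z | U (sre (c * z))]).
rewrite openE => z /= Uz; rewrite /interior -nbhs_ballE.
have [e /= e0 eU] : exists2 e : R, 0 < e & ball (sre (c * z)) e `<=` U.
  by apply/nbhs_ballP; exact: open_nbhs_nbhs.
have c0 : 0 < sre `|c| + 1 by rewrite ltr_wpDl ?sre_norm_ge0.
(* Multiplication by [c] followed by the real part is Lipschitz with constant |c|; the added 1
   covers [c = 0]. *)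
exists (@sreal R k (e / (sre `|c| + 1))) => /=.
  by rewrite -(rmorph0 (@sreal R k)) sreal_lt divr_gt0.
move=> w; rewrite -ball_normE /= (sre_norm (z - w)) sreal_lt ltr_pdivlMr// => zw.
apply: eU; rewrite -ball_normE /= -raddfB -mulrBr.
rewrite (le_lt_trans (normr_sre _))// sre_normM (le_lt_trans _ zw)//.
by rewrite mulrC ler_wpM2l ?sre_norm_ge0// lerDl.
Qed.

Lemma measurable_sreM d (T : measurableType d) (a b : T -> F) :
  scalar_measurable a -> scalar_measurable b ->
  measurable_fun setT (fun t => sre (a t * b t)).
Proof.
rewrite /scalar_measurable; case: k a b => /= a b ma mb.
  apply: measurable_funM.
    by have := ma 1; under eq_fun do rewrite /= mul1r.
  by have := mb 1; under eq_fun do rewrite /= mul1r.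
have ReIm (g : T -> R[i]) :
    (forall c : R[i], measurable_fun setT (fun t => complex.Re (c * g t))) ->
    measurable_fun setT (fun t => complex.Re (g t)) /\
    measurable_fun setT (fun t => complex.Im (g t)).
  move=> mg; split.
    by have := mg 1; under eq_fun do rewrite /= mul1r.
  (* The imaginary part of z is the real part of -i z, an instance of the hypothesis. *)
  rewrite (_ : (fun _ => _) = (fun t => complex.Re ((- 'i)%C * g t))); first exact: mg.
  by apply/funext => t; rewrite mulNr raddfN /= mulrC ReiNIm opprK.
have [ra ia] := ReIm _ ma; have [rb ib] := ReIm _ mb.
rewrite (_ : (fun _ => _) = (fun t => complex.Re (a t) * complex.Re (b t) -
    complex.Im (a t) * complex.Im (b t))); last first.
  by apply/funext => t; case: (a t) (b t) => [x y] [x' y'].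
by apply: measurable_funB; exact: measurable_funM.
Qed.

End scalar_measurability.

(** * Weakly measurable maps into a separable Hilbert space *)

Section weak_measurability.
Context {R : realType} {k : field_kind}.
Local Notation F := (base_field R k).
Context {H : completeNormedModType F} {ip : {dot H for @sconj R k}}.
Hypothesis hip : hilbert_product ip.
Hypothesis hsep : separable H.

(** Real parts suffice: [u] ranges over all vectors, so over complex scalars i u also captures the
    imaginary part. *)
Definition weakly_measurable d (T : measurableType d) (phi : T -> H) :=
  forall u, measurable_fun setT (fun t => rip ip u (phi t)).

Lemma separable_seq : exists e : nat -> H,
  forall u (eps : R), 0 < eps -> exists n, rnorm (u - e n) < eps.
Proof.
have [S cS dS] := hsep.
have dense_ball u (eps : R) : 0 < eps -> exists2 v, S v & rnorm (u - v) < eps.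
  move=> e0; have se0 : 0 < @sreal R k eps by rewrite -(rmorph0 (@sreal R k)) sreal_lt.
  have [|v [uv Sv]] := dS (ball u (@sreal R k eps)) _ (ball_open _ _).
    by exists u; exact: ballxx se0.
  exists v => //; move: uv; rewrite -ball_normE /=.
  by rewrite rnorm_sreal sreal_lt.
move: cS => /pfcard_geP[S0|[e]].
  by have [v] := dense_ball 0 1 ltr01; rewrite S0.
exists e => u eps /(dense_ball u)[v Sv uv].
by have [n _ en] := 'surj_e Sv; exists n; rewrite en.
Qed.

Context {d} {T : measurableType d}.
Implicit Types phi psi : T -> H.

Lemma weakly_measurable_cst u : weakly_measurable (fun _ : T => u).
Proof. by move=> v; exact: measurable_cst. Qed.

Lemma weakly_measurableD phi psi : weakly_measurable phi -> weakly_measurable psi ->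
  weakly_measurable (fun t => phi t + psi t).
Proof.
by move=> mp mq u; under eq_fun do rewrite ripDr; exact: measurable_funD.
Qed.

Lemma weakly_measurableB phi psi : weakly_measurable phi -> weakly_measurable psi ->
  weakly_measurable (fun t => phi t - psi t).
Proof.
by move=> mp mq u; under eq_fun do rewrite ripBr; exact: measurable_funB.
Qed.

Lemma weakly_measurable_sum I (s : seq I) (phi : I -> T -> H) :
  (forall i, weakly_measurable (phi i)) ->
  weakly_measurable (fun t => \sum_(i <- s) phi i t).
Proof.
move=> mp u; under eq_fun do rewrite rip_sumr.
by apply: measurable_sum => i; exact: mp.
Qed.

Lemma weakly_measurableZ (a : T -> F) phi : scalar_measurable a ->
  weakly_measurable phi -> weakly_measurable (fun t => a t *: phi t).
Proof.
move=> ma mp u; under eq_fun do rewrite rip_scale.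
apply: measurable_sreM => // c.
rewrite (_ : (fun _ => _) = (fun t => rip ip (sconj c *: u) (phi t))); first exact: mp.
by apply/funext => t; rewrite -rip_scale /rip linearZr_LR linearZl_LR.
Qed.

(* The norm of v is at most c exactly when Re <e_n, v> <= |e_n| c for every n,
   where (e_n) is dense. *)
Lemma measurable_rnorm phi : weakly_measurable phi ->
  measurable_fun setT (fun t => rnorm (phi t)).
Proof.
move=> mp; have [e eP] := separable_seq.
have normP v c : rnorm v <= c <-> 0 <= c /\ forall n, rip ip (e n) v <= rnorm (e n) * c.
  split=> [vc|[c0 ec]].
    split; first exact: le_trans (rnorm_ge0 v) vc.
    by move=> n; rewrite (le_trans (rip_le hip _ _))// ler_wpM2l ?rnorm_ge0.
  (* Half of [eps] pays for the factor [c + rnorm v] below, which is less than [2 * rnorm v] if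
     [c + eps < rnorm v]. *)
  apply/ler_addgt0Pr => eps eps0; have [n vn] := eP v (eps / 2) (divr_gt0 eps0 (ltr0Sn _ 1)).
  have h1 := rip_le hip (v - e n) v; have := ec n.
  have -> : e n = v - (v - e n) by rewrite opprB addrC subrK.
  rewrite ripBl ripvv// => h2.
  have h3 : rnorm (v - (v - e n)) <= rnorm v + rnorm (v - e n).
    by rewrite (le_trans (rnormD _ _))// lerD2l /rnorm normrN.
  have [v0|v0] := eqVneq (rnorm v) 0; first by rewrite v0 addr_ge0// ltW.
  have {}v0 : 0 < rnorm v by rewrite lt_neqAle eq_sym v0 rnorm_ge0.
  have h4 : rnorm v ^+ 2 <= rnorm v * c + rnorm (v - e n) * (c + rnorm v).
    by have h := ler_wpM2r c0 h3; move: h1 h2 h; rewrite mulrDl; lra.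
  rewrite leNgt; apply/negP => h5.
  have h6 : rnorm (v - e n) * (c + rnorm v) <= eps / 2 * (c + rnorm v).
    by apply: ler_wpM2r; [rewrite addr_ge0// ltW|exact: ltW].
  nra.
apply: (measurability _ (RGenOInfty.measurableE R)).
move=> _ [_ [c ->] <-]; rewrite setTI.
rewrite [X in measurable X](_ : _ = ~` [set t | rnorm (phi t) <= c]); last first.
  by apply/seteqP; split=> t /=; rewrite in_itv /= andbT ltNge => /negP.
apply: measurableC; have [c0|c0] := leP 0 c; last first.
  rewrite [X in measurable X](_ : _ = set0)//; apply/seteqP; split=> t //=.
  by move=> h; have := le_lt_trans h c0; rewrite ltNge rnorm_ge0.
rewrite [X in measurable X](_ : _ =
    \bigcap_n [set t | rip ip (e n) (phi t) <= rnorm (e n) * c]); last first.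
  apply/seteqP; split=> t /=; first by move/normP => [_ h] n _; exact: h.
  by move=> h; apply/normP; split=> // n; exact: h.
apply: bigcap_measurableType => n _.
rewrite -[X in measurable X]setTI.
by apply: measurable_fun_ler => //; exact: mp.
Qed.

(** Polarization reduces the case of two varying arguments to norms. *)
Lemma measurable_rip phi psi : weakly_measurable phi -> weakly_measurable psi ->
  measurable_fun setT (fun t => rip ip (phi t) (psi t)).
Proof.
move=> mp mq; under eq_fun do rewrite rip_polarization//.
apply: measurable_funM => //; apply: measurable_funB; apply: measurable_funX.
  by apply: measurable_rnorm; exact: weakly_measurableD.
by apply: measurable_rnorm; exact: weakly_measurableB.
Qed.

End weak_measurability.
Arguments weakly_measurable {R k H} ip {d T} phi.

Lemma weakly_measurable_comp {R : realType} {k : field_kind}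
  {H : completeNormedModType (base_field R k)} {ip : {dot H for @sconj R k}}
  d d' (T : measurableType d) (T' : measurableType d') (phi : T -> H) (g : T' -> T) :
  measurable_fun setT g -> weakly_measurable ip phi -> weakly_measurable ip (phi \o g).
Proof. by move=> mg mp u; exact: (measurableT_comp (mp u)). Qed.

(** * Weak measurability of the kernel sections *)

Section kernel_measurability.
Context {R : realType} {k : field_kind}.
Local Notation F := (base_field R k).
Context {H : completeNormedModType F} {ip : {dot H for @sconj R k}}.
Hypothesis hip : hilbert_product ip.
Context d (X : measurableType d).
Context {ev : H -> X -> F} {K : X -> X -> F} {ksec : X -> H}.
Hypothesis hK : reproducing_kernel ip ev K ksec.
Hypothesis mK : borel_measurable (fun z : X * X => K z.1 z.2).

(* The vectors u for which all x |-> Re <c u, K_x> are measurable form a closed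
   subspace containing every K_y, and the K_y are total in H. *)
Lemma weakly_measurable_ksec : weakly_measurable ip ksec.
Proof.
pose M : set H := [set u | forall c : F,
  measurable_fun setT (fun x => rip ip (c *: u) (ksec x))].
have M0 : M 0.
  by move=> c; under eq_fun do rewrite scaler0 ripC rip0r; exact: measurable_cst.
have MD u v : M u -> M v -> M (u + v).
  move=> Mu Mv c; under eq_fun do rewrite scalerDr ripDl.
  exact: measurable_funD.
have MZ (c : F) u : M u -> M (c *: u).
  by move=> Mu b; under eq_fun do rewrite scalerA; exact: Mu.
have Mcl : closed M.
  move=> u; rewrite closureEcvg => -[G PG [Gu MG]] c.
  (* Measurability passes to pointwise limits of sequences, so a sequence in [M] converging to [u]
     is extracted from the filter. *)
  have /choice[s sP] (n : nat) : exists v, M v /\ rnorm (v - u) < n.+1%:R^-1.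
    have e0 : 0 < @sreal R k n.+1%:R^-1.
      by rewrite -(rmorph0 (@sreal R k)) sreal_lt invr_gt0.
    have Gb : G (ball u (@sreal R k n.+1%:R^-1)) by apply: Gu; exact: nbhsx_ballx.
    have GM : G M by apply: MG; exact: subset_refl.
    have [v [vb Mv]] := filter_ex (filterI Gb GM).
    exists v; split=> //; move: vb; rewrite -ball_normE /= rnorm_sreal sreal_lt.
    by rewrite rnormB.
  have su : s n @[n --> \oo] --> u.
    apply/cvg_rnorm/(@squeeze_cvgr _ _ _ _ (cst 0) (fun n => n.+1%:R^-1)).
    - by apply: nearW => n; rewrite rnorm_ge0 ltW//; have [] := sP n.
    - exact: cvg_cst.
    - exact: cvg_harmonic.
  apply: (@measurable_fun_cvg _ _ _ _ (fun n x => rip ip (c *: s n) (ksec x))).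
    by move=> n; have [+ _] := sP n; exact.
  by move=> x _; under eq_fun do rewrite rip_adj ripC; rewrite rip_adj ripC; exact: cvg_rip.
(* The inner product of [ksec y] and [ksec x] is [K x y], and joint measurability of [K] restricts
   to slices. *)
have MK y : M (ksec y).
  move=> c; rewrite (_ : (fun _ => _) = (fun x => sre (c * K x y))); last first.
    apply/funext => x; rewrite /rip linearZl_LR /= -(reproducing hK).
    by rewrite (ev_ksec hK).
  have : scalar_measurable (fun x => K x y).
    apply: borel_scalar_measurable => U oU.
    have mp : measurable_fun setT (fun x : X => (x, y)) by exact: measurable_pair2.
    by have := mp measurableT _ (mK oU); rewrite setTI.
  exact.
move=> u; have [m Mm um] := closed_subspace_proj hip u M0 MD (fun a => MZ _) Mcl.
(* [u - m] is orthogonal to every multiple of every [ksec x]; by the reproducing property it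
   vanishes as a function on [X]. *)
have -> : u = m.
  apply/eqP; rewrite -subr_eq0; apply/eqP/(ev_inj hK)/funext => x.
  rewrite !(reproducing hK) linear0l; apply: ip_eq0 => c.
  by rewrite rip_adj um//; exact/MZ/MK.
by have := Mm 1; under eq_fun do rewrite scale1r.
Qed.

End kernel_measurability.

(** * Gram-Schmidt residuals and orthogonal projection on a finite span *)

Section gram_schmidt.
Context {R : realType} {k : field_kind}.
Local Notation F := (base_field R k).
Context {H : completeNormedModType F} {ip : {dot H for @sconj R k}}.
Hypothesis hip : hilbert_product ip.
Implicit Types (f g u w : H).

(** What remains of [f] after projection on the span of the first [n] vectors. Linear dependence
    needs no case distinction: if [w] is 0, the subtracted term is 0. Unlike the choice made by
    [orth_proj], this explicit formula is visibly measurable in its data. *)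
Fixpoint gs_residual (v : nat -> H) n f : H :=
  if n is n'.+1 then
    let r := gs_residual v n' f in
    let w := gs_residual v n' (v n') in
    r - (@sreal R k (rnorm w ^+ 2)^-1 * ip r w) *: w
  else f.

Lemma gs_residual_span (v : nat -> H) n f :
  exists c : nat -> F, f - gs_residual v n f = \sum_(i < n) c i *: v i.
Proof.
elim: n f => [|n IH] f /=; first by exists (fun=> 0); rewrite big_ord0 subrr.
have [c cP] := IH f; have [b bP] := IH (v n).
set r := gs_residual v n f in cP *; set w := gs_residual v n (v n) in bP *.
set a := sreal _ * _.
(* The new residual is [r - a *: w], and [w] is [v n] minus the combination with coefficients
   [b]. *)
exists (fun i => if i == n then a else c i - a * b i).
rewrite big_ord_recr /= eqxx.
under eq_bigr => i _ do rewrite ltn_eqF// scalerBl -scalerA.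
rewrite sumrB -cP -scaler_sumr -bP scalerBr !opprB -[RHS]addrA subrK.
by rewrite -[RHS]addrA [- r + _]addrC.
Qed.

Lemma gs_residual_orth (v : nat -> H) n f i :
  (i < n)%N -> ip (gs_residual v n f) (v i) = 0.
Proof.
elim: n f i => // n IH f i; rewrite ltnS leq_eqVlt => /orP[/eqP ->|i_n] /=;
  last by rewrite linearBl linearZl_LR /= !IH// mulr0 subr0.
set r := gs_residual v n f; set w := gs_residual v n (v n).
(* [v n - w] is a combination of the earlier vectors, to which residuals are orthogonal by
   induction. *)
have orth g : ip (gs_residual v n g) (v n) = ip (gs_residual v n g) w.
  have [b bP] := gs_residual_span v n (v n).
  apply/eqP; rewrite -subr_eq0 -linearBr bP linear_sumr big1// => j _.
  by rewrite linearZr_LR /= IH// mulr0.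
rewrite linearBl linearZl_LR /= !orth -/w -hip rnorm_sreal -rmorphXn /=.
have [w0|w0] := eqVneq (rnorm w) 0.
  by rewrite (rnorm_eq0 w0) linear0r mulr0 mul0r subr0.
rewrite mulrAC -rmorphM /= mulVf ?rmorph1 ?mul1r ?subrr//.
by rewrite expf_eq0.
Qed.

(** Padding by 0 lets the recursion over [nat] run on a finite family. *)
Definition ord_extend n (v : 'I_n -> H) (j : nat) : H := oapp v 0 (insub j).

Lemma ord_extendE n (v : 'I_n -> H) i : ord_extend v (nat_of_ord i) = v i.
Proof. by rewrite /ord_extend valK. Qed.

(** Gram-Schmidt provides a projection, so [xget] does not fall back on its default. The two
    projections agree because their difference lies in the span and is orthogonal to it. *)
Lemma orth_projP n (v : 'I_n -> H) f :
  [/\ lin_span v (orth_proj ip (lin_span v) f),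
      forall g, lin_span v g -> ip (f - orth_proj ip (lin_span v) f) g = 0 &
      f - orth_proj ip (lin_span v) f = gs_residual (ord_extend v) n f].
Proof.
pose r := gs_residual (ord_extend v) n f.
have Sr : lin_span v (f - r).
  have [c cP] := gs_residual_span (ord_extend v) n f.
  by exists (fun i => c i) => //; rewrite cP; apply: eq_bigr => i _; rewrite ord_extendE.
have Or g : lin_span v g -> ip r g = 0.
  move=> [c _ <-]; rewrite linear_sumr big1// => i _.
  by rewrite linearZr_LR /= -(ord_extendE v) gs_residual_orth// mulr0.
have [Sp Op] : lin_span v (orth_proj ip (lin_span v) f) /\
    forall g, lin_span v g -> ip (f - orth_proj ip (lin_span v) f) g = 0.
  apply: (@xgetPex _ 0 [set g | lin_span v g /\
    forall u, lin_span v u -> ip (f - g) u = 0]).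
  by exists (f - r); split=> // u Su; rewrite subKr Or.
split=> //; set p := orth_proj _ _ _ in Sp Op *.
have Spr : lin_span v (p - (f - r)).
  have [c _ cP] := Sp; have [b _ bP] := Sr.
  exists (fun i => c i - b i) => //; rewrite -cP -bP -sumrB.
  by apply: eq_bigr => i _; rewrite scalerBl.
have e : p - (f - r) = r - (f - p) by rewrite !opprB addrCA.
apply/esym/eqP; rewrite -subr_eq0 -/r -e; apply/eqP/rnorm_eq0/eqP.
by rewrite -sqrf_eq0 -(ripvv hip) {1}e ripBl /rip Or// Op// raddf0 subr0.
Qed.

(** Pythagoras for [f - p] and [p - g], the latter being in the span. *)
Lemma orth_proj_le n (v : 'I_n -> H) f g : lin_span v g ->
  rnorm (f - orth_proj ip (lin_span v) f) <= rnorm (f - g).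
Proof.
move=> Sg; have [Sp Op _] := orth_projP v f; set p := orth_proj _ _ _ in Sp Op *.
rewrite -(ler_pXn2r (ltn0Sn 1)) ?nnegrE ?rnorm_ge0//.
have -> : f - g = (f - p) + (p - g) by rewrite addrA subrK.
have Spg : lin_span v (p - g).
  have [c _ cP] := Sp; have [b _ bP] := Sg.
  exists (fun i => c i - b i) => //; rewrite -cP -bP -sumrB.
  by apply: eq_bigr => i _; rewrite scalerBl.
by rewrite (rnormD_sqr hip (f - p)) /rip Op// raddf0 mulr0 addr0 lerDl sqr_ge0.
Qed.

Hypothesis hsep : separable H.

Lemma weakly_measurable_gs d (T : measurableType d) (v : nat -> T -> H) (phi : T -> H) n :
  (forall j, weakly_measurable ip (v j)) -> weakly_measurable ip phi ->
  weakly_measurable ip (fun t => gs_residual (v ^~ t) n (phi t)).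
Proof.
move=> mv; elim: n phi => // n IH phi mp /=.
have mr := IH _ mp; have mw := IH _ (mv n).
apply: weakly_measurableB => //; apply: weakly_measurableZ => // c.
rewrite (_ : (fun _ => _) = (fun t => (rnorm (gs_residual (v ^~ t) n (v n t)) ^+ 2)^-1 *
    rip ip (c *: gs_residual (v ^~ t) n (phi t)) (gs_residual (v ^~ t) n (v n t))));
  last by apply/funext => t; rewrite mulrCA sre_realM /rip linearZl_LR.
apply: measurable_funM.
  apply: measurable_funV; first by move=> t; exact: sqr_ge0.
  by apply: measurable_funX; exact: measurable_rnorm.
by apply: measurable_rip => //; exact: weakly_measurableZ.
Qed.

Lemma measurable_bad_set d (X : measurableType d) (ksec : X -> H) f n (delta : R) :
  weakly_measurable ip ksec -> measurable (bad_set ip ksec f n delta).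
Proof.
move=> mk; pose v j (t : n.-tuple X) := ord_extend (fun i => ksec (tnth t i)) j.
have mv j : weakly_measurable ip (v j).
  rewrite /v /ord_extend; case: insubP => [i _ _|_] /=.
    exact: (weakly_measurable_comp (measurable_tnth i) mk).
  exact: weakly_measurable_cst.
(* The projection is replaced by the residual formula, whose measurability in [t] is known. *)
rewrite (_ : bad_set _ _ _ _ _ =
    [set t | delta <= rnorm (gs_residual (v ^~ t) n f)]); last first.
  apply/seteqP; split=> t; rewrite /bad_set /=.
    by have [_ _ ->] := orth_projP (fun i => ksec (tnth t i)) f.
  by have [_ _ ->] := orth_projP (fun i => ksec (tnth t i)) f.
rewrite -[X in measurable X]setTI; apply: measurable_fun_ler => //.
by apply: (measurable_rnorm hip hsep); exact: weakly_measurable_gs.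
Qed.

End gram_schmidt.

(** * Bounded integrands and Markov's inequality *)

Lemma bounded_integrable {R : realType} d (X : measurableType d)
  (P : probability X R) (g : X -> R) (M : R) :
  measurable_fun setT g -> (forall x, `|g x| <= M) -> P.-integrable setT (EFin \o g).
Proof.
move=> mg gM; apply: measurable_bounded_integrable => //.
  by rewrite (le_lt_trans (probability_le1 P measurableT))// ltry.
by exists M; split; [exact: num_real|move=> N /ltW MN x _; exact: le_trans (gM x) MN].
Qed.

Lemma markov_ge0 {R : realType} d (X : measurableType d) (P : probability X R)
  (g : X -> R) (eps : R) : measurable_fun setT g -> (forall x, 0 <= g x) -> 0 < eps ->
  (P [set x | (eps <= g x)%R] <= (eps^-1)%:E * \int[P]_x (g x)%:E)%E.
Proof.
move=> mg g0 e0.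
have mE : measurable [set x | eps <= g x].
  by rewrite -[X in measurable X]setTI; apply: measurable_fun_ler.
rewrite lee_pdivlMl// -(setIT [set _ | _]) -integral_indic//.
rewrite -ge0_integralZl_EFin//; last 2 first.
- by apply/measurable_EFinP; exact: measurable_indic.
- exact: ltW.
apply: ge0_le_integral => //.
- by move=> x _; rewrite lee_fin mulr_ge0// ltW.
- by apply/measurable_EFinP; apply: measurable_funM => //; exact: measurable_indic.
- exact/measurable_EFinP.
- move=> x _; rewrite lee_fin indicE; have [xE|_] := boolP (x \in _).
    by rewrite mulr1; move: xE; rewrite inE.
  by rewrite mulr0.
Qed.

(** * Integration against powers of [P] *)

Section product_power_integral.
Context {R : realType} d (X : measurableType d) (P : probability X R).

(** Tonelli with the head coordinate innermost, the form used by the inductions on [n]. *)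
Lemma integral_prob_powerS n (g : n.+1.-tuple X -> \bar R) :
  measurable_fun setT g -> (forall t, 0 <= g t)%E ->
  (\int[prob_power P n.+1]_t g t =
   \int[prob_power P n]_t \int[P]_x g (cons_pair (x, t)))%E.
Proof.
move=> mg g0; rewrite /= ge0_integral_distribution//.
rewrite (@fubini_tonelli2 _ _ _ _ _ P (prob_power P n) (g \o @cons_pair _ _ n))//.
  by apply: measurableT_comp => //; exact: measurable_cons_pair.
by move=> z; exact: g0.
Qed.

Lemma integral_prob_power_sum n (g : X -> R) :
  measurable_fun setT g -> (forall x, 0 <= g x) ->
  (\int[prob_power P n]_t (\sum_(i < n) g (tnth t i))%:E =
   n%:R%:E * \int[P]_x (g x)%:E)%E.
Proof.
move=> mg g0.
have mS m : measurable_fun setT (fun t : m.-tuple X => \sum_(i < m) g (tnth t i)).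
  by apply: measurable_sum => i; apply: measurableT_comp => //; exact: measurable_tnth.
have S0 m (t : m.-tuple X) : 0 <= \sum_(i < m) g (tnth t i) by exact: sumr_ge0.
have i0 : (0 <= \int[P]_x (g x)%:E)%E by apply: integral_ge0 => x _; rewrite lee_fin.
elim: n => [|n IH]; first by rewrite integral0_eq ?mul0e// => t _; rewrite big_ord0.
rewrite integral_prob_powerS//; last 2 first.
- by apply/measurable_EFinP; exact: mS.
- by move=> t; rewrite lee_fin.
transitivity (\int[prob_power P n]_t
    (\int[P]_x (g x)%:E + (\sum_(i < n) g (tnth t i))%:E))%E.
  apply: eq_integral => t _.
  transitivity (\int[P]_x ((g x)%:E + (\sum_(i < n) g (tnth t i))%:E))%E.
    apply: eq_integral => x _; rewrite big_ord_recl tnth0 EFinD; congr (_ + _%:E)%E.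
    by apply: eq_bigr => i _; rewrite tnthS.
  rewrite ge0_integralD//; last 3 first.
  - by move=> x _; rewrite lee_fin.
  - exact/measurable_EFinP.
  - by move=> x _; rewrite lee_fin.
  by rewrite integral_cst// [X in (_ * X)%E]probability_setT mule1.
rewrite ge0_integralD//; last 2 first.
- by move=> t _; rewrite lee_fin.
- by apply/measurable_EFinP; exact: mS.
rewrite integral_cst// [X in (_ * X)%E]probability_setT mule1 [X in (_ + X)%E]IH.
by rewrite -[in RHS]natr1 EFinD ge0_muleDl ?lee_fin// mul1e addeC.
Qed.

End product_power_integral.

(** * Second moment of a sum of independent centred vectors *)

Section second_moment.
Context {R : realType} {k : field_kind}.
Local Notation F := (base_field R k).
Context {H : completeNormedModType F} {ip : {dot H for @sconj R k}}.
Hypothesis hip : hilbert_product ip.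
Hypothesis hsep : separable H.
Context d (X : measurableType d) (P : probability X R).

Lemma weakly_measurable_tnth_sum n (s : X -> H) : weakly_measurable ip s ->
  weakly_measurable ip (fun t : n.-tuple X => \sum_(i < n) s (tnth t i)).
Proof.
move=> ms; apply: weakly_measurable_sum => i.
exact: (weakly_measurable_comp (measurable_tnth i) ms).
Qed.

(* Integrating out one coordinate at a time kills the cross terms. *)
Lemma integral_sqr_rnorm_sum n (s : X -> H) (M : R) :
  weakly_measurable ip s -> (forall x, rnorm (s x) <= M) ->
  (forall u, \int[P]_x (rip ip u (s x))%:E = 0)%E ->
  (\int[prob_power P n]_t (rnorm (\sum_(i < n) s (tnth t i)) ^+ 2)%:E =
   n%:R%:E * \int[P]_x (rnorm (s x) ^+ 2)%:E)%E.
Proof.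
move=> ms sM s0.
have mS m : measurable_fun setT
    (fun t : m.-tuple X => rnorm (\sum_(i < m) s (tnth t i)) ^+ 2).
  apply: measurable_funX; apply: (measurable_rnorm hip hsep).
  exact: weakly_measurable_tnth_sum.
have i0 : (0 <= \int[P]_x (rnorm (s x) ^+ 2)%:E)%E.
  by apply: integral_ge0 => x _; rewrite lee_fin sqr_ge0.
have intS : P.-integrable setT (EFin \o (fun x => rnorm (s x) ^+ 2)).
  apply: (@bounded_integrable _ _ _ _ _ (M ^+ 2)).
    by apply: measurable_funX; exact: (measurable_rnorm hip hsep).
  move=> x; rewrite ger0_norm ?sqr_ge0// lerXn2r ?nnegrE ?rnorm_ge0//.
  exact: le_trans (rnorm_ge0 _) (sM x).
(* The cross term has no sign; the bound [M] makes it integrable, so that the integral can be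
   split. *)
have intR u : P.-integrable setT (EFin \o (fun x => rip ip u (s x))).
  apply: (@bounded_integrable _ _ _ _ _ (rnorm u * M)); first exact: ms.
  by move=> x; rewrite (le_trans (rip_norm_le hip _ _))// ler_wpM2l ?rnorm_ge0.
have step u : (\int[P]_x (rnorm (s x + u) ^+ 2)%:E =
    \int[P]_x (rnorm (s x) ^+ 2)%:E + (rnorm u ^+ 2)%:E)%E.
  under eq_integral => x _.
    rewrite (rnormD_sqr hip) (ripC _ u) -addrA EFinD EFinD (EFinM 2); over.
  rewrite integralD//; last first.
    apply: integrableD => //; first exact: (integrableZl measurableT 2 (intR u)).
    exact: finite_measure_integrable_cst.
  rewrite integralD//; last 2 first.
  - exact: (integrableZl measurableT 2 (intR u)).
  - exact: finite_measure_integrable_cst.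
  rewrite (integralZl measurableT (intR u)) s0 mule0 add0e integral_cst//.
  by rewrite [X in (_ * X)%E]probability_setT mule1.
elim: n => [|n IH].
  by rewrite integral0_eq ?mul0e// => t _; rewrite big_ord0 rnorm0 expr0n.
rewrite integral_prob_powerS//; last 2 first.
- by apply/measurable_EFinP; exact: mS.
- by move=> t; rewrite lee_fin sqr_ge0.
transitivity (\int[prob_power P n]_t (\int[P]_x (rnorm (s x) ^+ 2)%:E +
    (rnorm (\sum_(i < n) s (tnth t i)) ^+ 2)%:E))%E.
  apply: eq_integral => t _; rewrite -step.
  apply: eq_integral => x _; rewrite big_ord_recl tnth0.
  by under eq_bigr do rewrite tnthS.
rewrite ge0_integralD//; last 2 first.
- by move=> t _; rewrite lee_fin sqr_ge0.
- by apply/measurable_EFinP; exact: mS.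
rewrite integral_cst// [X in (_ * X)%E]probability_setT mule1 [X in (_ + X)%E]IH.
by rewrite -[in RHS]natr1 EFinD ge0_muleDl ?lee_fin// mul1e addeC.
Qed.

End second_moment.

(** * Weak law of large numbers for Bochner integrals *)

Section bochner_law_of_large_numbers.
Context {R : realType} {k : field_kind}.
Local Notation F := (base_field R k).
Context {H : completeNormedModType F} {ip : {dot H for @sconj R k}}.
Hypothesis hip : hilbert_product ip.
Hypothesis hsep : separable H.
Context d (X : measurableType d) (P : probability X R).

Section simple.
Variable s : X -> H.
Hypothesis hs : simple_fun s.

Let vals : seq H := finmap.enum_fset (fset_set (range s)).

Let mem_vals v : (v \in vals) = (v \in range s).
Proof. by rewrite -in_fset_set//; case: hs. Qed.

Let uniq_vals : uniq vals.
Proof. exact: finmap.fset_uniq. Qed.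

(** Exactly one indicator is nonzero at [x]. Measurability and integrals of real functionals of [s]
    thus reduce to indicators. *)
Lemma simple_fun_expand (g : H -> R) x :
  g (s x) = \sum_(v <- vals) g v * \1_(s @^-1` [set v]) x.
Proof.
have sx : s x \in vals by rewrite mem_vals inE; exists x.
rewrite (bigD1_seq _ sx uniq_vals)/= indicE mem_set// mulr1.
rewrite big1 ?addr0// => v vx; rewrite indicE memNset ?mulr0// => /= sxv.
by rewrite sxv eqxx in vx.
Qed.

Lemma simple_fun_weakly_measurable : weakly_measurable ip s.
Proof.
move=> u; under eq_fun do rewrite (simple_fun_expand (rip ip u)).
apply: measurable_sum => v; apply: measurable_funM => //.
by apply: measurable_indic; case: hs.
Qed.

Lemma simple_fun_bounded : exists M, forall x, rnorm (s x) <= M.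
Proof.
exists (\sum_(v <- vals) rnorm v) => x.
have sx : s x \in vals by rewrite mem_vals inE; exists x.
rewrite (bigD1_seq _ sx uniq_vals)/= lerDl sumr_ge0// => v _.
exact: rnorm_ge0.
Qed.

Lemma integral_rip_simple u :
  (\int[P]_x (rip ip u (s x))%:E = (rip ip u (simple_integral P s))%:E)%E.
Proof.
have [fs ms] := hs.
under eq_integral do rewrite (simple_fun_expand (rip ip u)) -sumEFin.
have int1 v : P.-integrable setT (fun x => (\1_(s @^-1` [set v]) x)%:E : \bar R).
  exact: integrable_indic.
rewrite integral_sum//; last first.
  by move=> v; under eq_fun do rewrite EFinM; exact: integrableZl.
rewrite /simple_integral fsbig_finite//= rip_sumr -sumEFin.
apply: eq_bigr => v _; under eq_integral do rewrite EFinM.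
rewrite integralZl// integral_indic// setIT ripZr EFinM muleC.
by rewrite fineK// fin_num_measure.
Qed.

End simple.

Lemma integral_rip_centered (s : X -> H) u : simple_fun s ->
  (\int[P]_x (rip ip u (s x - simple_integral P s))%:E = 0)%E.
Proof.
move=> hs; have [M sM] := simple_fun_bounded hs.
under eq_integral do rewrite ripBr EFinB.
rewrite integralB_EFin//.
- rewrite integral_rip_simple// integral_cst// [X in (_ * X)%E]probability_setT.
  by rewrite mule1 subee.
- apply: (@bounded_integrable _ _ _ _ _ (rnorm u * M)).
    exact: simple_fun_weakly_measurable.
  by move=> x; rewrite (le_trans (rip_norm_le hip _ _))// ler_wpM2l ?rnorm_ge0.
- exact: finite_measure_integrable_cst.
Qed.

Lemma rnorm_sum_le (I : Type) (r : seq I) (g : I -> H) :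
  rnorm (\sum_(i <- r) g i) <= \sum_(i <- r) rnorm (g i).
Proof.
elim: r => [|i r IH]; first by rewrite !big_nil rnorm0.
by rewrite !big_cons (le_trans (rnormD _ _))// lerD2l.
Qed.

(** Sum against [n%:R * eps] instead of mean against [eps], which avoids dividing by [n]. *)
Definition deviation_set (h : X -> H) (u : H) (n : nat) (eps : R) : set (n.-tuple X) :=
  [set t | n%:R * eps <= rnorm (\sum_(i < n) (h (tnth t i) - u))].
Arguments deviation_set h u n eps : clear implicits.

Lemma measurable_deviation_set (h : X -> H) u n eps :
  weakly_measurable ip h -> measurable (deviation_set h u n eps).
Proof.
move=> mh; rewrite -[X in measurable X]setTI; apply: measurable_fun_ler => //.
apply: (measurable_rnorm hip hsep).
apply: (weakly_measurable_tnth_sum (s := fun x => h x - u)).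
by apply: weakly_measurableB => //; exact: weakly_measurable_cst.
Qed.

(** Split [h - u] into [h - s], [s - I] and [I - u], with [I] the integral of [s]. The last part
    contributes at most [n%:R * eps] to the sum, so one of the other two must reach [n%:R * eps]:
    Markov bounds the first event, Chebyshev the second. *)
Lemma prob_deviation_le (h s : X -> H) u n (eps : R) :
  weakly_measurable ip h -> simple_fun s -> 0 < eps -> (0 < n)%N ->
  rnorm (simple_integral P s - u) <= eps ->
  (prob_power P n (deviation_set h u n (3 * eps)) <=
    (eps^-1)%:E * \int[P]_x (rnorm (h x - s x))%:E +
    ((eps ^+ 2)^-1 / n%:R)%:E *
      \int[P]_x (rnorm (s x - simple_integral P s) ^+ 2)%:E)%E.
Proof.
move=> mh hs eps0 n0 su.
set I := simple_integral P s in su *.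
have n0' : 0 < n%:R :> R by rewrite ltr0n.
have ms := simple_fun_weakly_measurable hs.
have mhs : weakly_measurable ip (fun x => h x - s x) by exact: weakly_measurableB.
have msI : weakly_measurable ip (fun x => s x - I).
  by apply: weakly_measurableB => //; exact: weakly_measurable_cst.
have mg : measurable_fun setT (fun x => rnorm (h x - s x)).
  exact: (measurable_rnorm hip hsep).
pose S1 (t : n.-tuple X) := \sum_(i < n) rnorm (h (tnth t i) - s (tnth t i)).
pose S2 (t : n.-tuple X) := rnorm (\sum_(i < n) (s (tnth t i) - I)) ^+ 2.
have mS1 : measurable_fun setT S1.
  by apply: measurable_sum => i; apply: (measurableT_comp mg); exact: measurable_tnth.
have mS2 : measurable_fun setT S2.
  apply: measurable_funX; apply: (measurable_rnorm hip hsep).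
  exact: (weakly_measurable_tnth_sum (s := fun x => s x - I)).
pose A := [set t | n%:R * eps <= S1 t]; pose B := [set t | (n%:R * eps) ^+ 2 <= S2 t].
have mA : measurable A by rewrite -[A]setTI; exact: measurable_fun_ler.
have mB : measurable B by rewrite -[B]setTI; exact: measurable_fun_ler.
have sub : deviation_set h u n (3 * eps) `<=` A `|` B.
  move=> t; rewrite /deviation_set /A /B /S2 /= => dev.
  have [a|a] := leP (n%:R * eps) (S1 t); [by left|right].
  apply: lerXn2r; rewrite ?nnegrE ?rnorm_ge0//; first by rewrite mulr_ge0 ?ltW.
  rewrite leNgt; apply/negP => b.
  have : rnorm (\sum_(i < n) (h (tnth t i) - u)) <=
      S1 t + (rnorm (\sum_(i < n) (s (tnth t i) - I)) + n%:R * rnorm (I - u)).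
    have -> : \sum_(i < n) (h (tnth t i) - u) =
      \sum_(i < n) (h (tnth t i) - s (tnth t i)) +
      (\sum_(i < n) (s (tnth t i) - I) + \sum_(i < n) (I - u)).
      rewrite -!big_split /=; apply: eq_bigr => i _.
      by rewrite [s _ - I + _]addrA subrK addrA subrK.
    rewrite (le_trans (rnormD _ _))// lerD ?rnorm_sum_le// (le_trans (rnormD _ _))//.
    rewrite lerD2l (le_trans (rnorm_sum_le _ _))//.
    by rewrite sumr_const card_ord mulr_natl.
  have := ler_wpM2l (ltW n0') su; lra.
have [M sM] := simple_fun_bounded hs.
apply: (@le_trans _ _ (prob_power P n (A `|` B))).
  apply: le_measure => //; rewrite ?inE//.
  - exact: measurable_deviation_set.
  - exact: measurableU.
apply: (le_trans (measureU2 _ _ _)) => //; apply: leeD.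
- apply: (le_trans (markov_ge0 _ _ _ _)) => //.
  + by move=> t; apply: sumr_ge0 => i _; exact: rnorm_ge0.
  + by rewrite mulr_gt0.
  rewrite (integral_prob_power_sum P n mg); last by move=> x; exact: rnorm_ge0.
  rewrite muleA -EFinM invfM mulrAC mulVf ?mul1r//.
  by rewrite gt_eqF.
- apply: (le_trans (markov_ge0 _ _ _ _)) => //.
  + by move=> t; exact: sqr_ge0.
  + by rewrite exprn_gt0// mulr_gt0.
  (* The second moment grows like [n] and the squared threshold like the square of [n], which leaves
     the factor 1/n. *)
  rewrite (integral_sqr_rnorm_sum hip hsep n msI (M := M + rnorm I)).
  + rewrite muleA -EFinM; apply: lee_wpmul2r.
      by apply: integral_ge0 => x _; rewrite lee_fin sqr_ge0.
    rewrite lee_fin le_eqVlt; apply/orP; left; apply/eqP.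
    by field; rewrite !gt_eqF.
  + by move=> x; rewrite (le_trans (rnormD _ _))// lerD// /rnorm normrN.
  + by move=> v; exact: integral_rip_centered.
Qed.

Lemma cvge0_probability (u : nat -> \bar R) :
  (forall n, 0 <= u n)%E ->
  (forall eta : R, 0 < eta -> \forall n \near \oo, (u n <= eta%:E)%E) ->
  u n @[n --> \oo] --> 0%E.
Proof.
(* The instance [eta = 1] makes the terms eventually finite, so the limit can be taken in the
   reals. *)
move=> u0 ue; have fin : \forall n \near \oo, u n \is a fin_num.
  have := ue 1 ltr01; apply: filterS => n un.
  by rewrite ge0_fin_numE// (le_lt_trans un)// ltry.
apply: cvg_EFin => //; apply/cvgrPdist_le => e e0.
near=> n.
have fn : u n \is a fin_num by near: n.
rewrite sub0r normrN ger0_norm ?fine_ge0//= -lee_fin fineK//.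
by near: n; exact: ue.
Unshelve. all: by end_near. Qed.

Lemma bochner_weak_law (h : X -> H) (u : H) (eps : R) :
  weakly_measurable ip h -> is_bochner_integral P h u -> 0 < eps ->
  prob_power P n (deviation_set h u n eps) @[n --> \oo] --> 0%E.
Proof.
move=> mh [s [hs _ s_int s_lim]] eps0.
apply: cvge0_probability => // eta eta0.
have e3 : 0 < eps / 3 by rewrite divr_gt0.
(* Markov multiplies the L^1 error by the inverse of [eps / 3], which leaves [eta / 2]. *)
have a0 : 0 < eta / 2 * (eps / 3) by rewrite mulr_gt0// divr_gt0.
have near1 : \forall m \near \oo,
    (\int[P]_x (rnorm (h x - s m x))%:E <= (eta / 2 * (eps / 3))%:E)%E.
  move/fine_cvgP : s_int => [fin /cvgrPdist_le/(_ _ a0) near_int].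
  apply: filterS2 fin near_int => m fm; rewrite sub0r normrN /= => hm.
  by rewrite -(fineK fm) lee_fin (le_trans (ler_norm _)).
have near2 : \forall m \near \oo, rnorm (simple_integral P (s m) - u) <= eps / 3.
  move/cvg_rnorm/cvgrPdist_le/(_ _ e3) : s_lim; apply: filterS => m.
  by rewrite sub0r normrN ger0_norm ?rnorm_ge0.
(* The simple function is fixed before [n] grows: its L^1 error term does not depend on [n], and its
   variance [C] is then divided by [n]. *)
have [m [m1 m2]] := filter_ex (filterI near1 near2).
set I := simple_integral P (s m) in m2.
have [M sM] := simple_fun_bounded (hs m).
have ms := simple_fun_weakly_measurable (hs m).
set C := (\int[P]_x (rnorm (s m x - I) ^+ 2)%:E)%E.
have C0 : (0 <= C)%E by apply: integral_ge0 => x _; rewrite lee_fin sqr_ge0.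
have Cfin : C \is a fin_num.
  apply: integrable_fin_num => //.
  apply: (@bounded_integrable _ _ _ _ _ ((M + rnorm I) ^+ 2)).
    apply: measurable_funX; apply: (measurable_rnorm hip hsep).
    by apply: weakly_measurableB => //; exact: weakly_measurable_cst.
  move=> x; rewrite ger0_norm ?sqr_ge0// lerXn2r ?nnegrE ?rnorm_ge0//.
    by rewrite addr_ge0 ?rnorm_ge0// (le_trans (rnorm_ge0 _) (sM x)).
  by rewrite (le_trans (rnormD _ _))// lerD// /rnorm normrN.
(* Chosen so that the Chebyshev term is at most [eta / 2]; the added 1 covers [C = 0]. *)
have b0 : 0 < eta / 2 * (eps / 3) ^+ 2 / (fine C + 1).
  rewrite divr_gt0// ?mulr_gt0 ?exprn_gt0// ?divr_gt0//.
  by rewrite ltr_wpDl// fine_ge0.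
have nearn : \forall n \near \oo, (n.+1%:R : R)^-1 < eta / 2 * (eps / 3) ^+ 2 / (fine C + 1).
  exact: (near_infty_natSinv_lt (PosNum b0)).
(* Starting at [N.+1] excludes the index 0 and writes every other index as a successor, as in
   [nearn]. *)
case: nearn => N _ NP; exists N.+1 => // -[//|n] /= /(NP n) hn.
have -> : eps = 3 * (eps / 3) by rewrite mulrC divfK.
apply: (le_trans (prob_deviation_le mh (hs m) e3 (ltn0Sn n) m2)).
rewrite [eta]splitr EFinD; apply: leeD.
  by rewrite lee_pdivrMl// -EFinM mulrC.
rewrite -/I -/C -(fineK Cfin) -EFinM lee_fin.
have fC : 0 <= fine C by exact: fine_ge0.
have e30 : 0 < (eps / 3) ^+ 2 by rewrite exprn_gt0.
rewrite -mulrA ler_pdivrMl// mulrC [_ ^+ 2 * _]mulrC.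
move: hn; rewrite ltr_pdivlMr ?ltr_wpDl// => /ltW; apply: le_trans.
by rewrite mulrC ler_wpM2l// ?invr_ge0// lerDl.
Qed.

End bochner_law_of_large_numbers.
Arguments deviation_set {R k H d X} h u n eps.

Import HBNNSimple.

(** * Probability of the bad sets *)

Section bad_sets.
Context {R : realType} {k : field_kind}.
Local Notation F := (base_field R k).
Context {H : completeNormedModType F} {ip : {dot H for @sconj R k}}.
Hypothesis hip : hilbert_product ip.
Hypothesis hsep : separable H.
Context d (X : measurableType d) (P : probability X R).
Context {K : X -> X -> F} {ksec : X -> H}.
Hypothesis mksec : weakly_measurable ip ksec.
Implicit Types f g : H.

Lemma bad_set_sub_deviation_set f u (l : X -> F) n (delta : R) : (0 < n)%N ->
  bad_set ip ksec f n delta `<=`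
  deviation_set (fun x => l x *: ksec x) u n (delta - rnorm (f - u)).
Proof.
move=> n0 t; rewrite /bad_set /deviation_set /= => bad.
have n0' : 0 < n%:R :> R by rewrite ltr0n.
(* The empirical mean, with 1/n inside the coefficients to exhibit membership in the span. *)
pose g := \sum_(i < n) (@sreal R k n%:R^-1 * l (tnth t i)) *: ksec (tnth t i).
have gE : g - u = @sreal R k n%:R^-1 *: \sum_(i < n) (l (tnth t i) *: ksec (tnth t i) - u).
  rewrite sumrB scalerBr scaler_sumr; congr (_ - _).
    by apply: eq_bigr => i _; rewrite scalerA.
  rewrite sumr_const card_ord -[u *+ n]scaler_nat scalerA.
  rewrite -(rmorph_nat (@sreal R k)) -rmorphM /=.
  by rewrite mulVf ?gt_eqF// rmorph1 scale1r.
have fg : delta <= rnorm (f - g).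
  rewrite (le_trans bad)//; apply: (orth_proj_le hip).
  by exists (fun i => @sreal R k n%:R^-1 * l (tnth t i)).
have : rnorm (g - u) * n%:R = rnorm (\sum_(i < n) (l (tnth t i) *: ksec (tnth t i) - u)).
  by rewrite gE rnormZ ger0_norm ?invr_ge0 ?ltW// mulrAC mulVf ?mul1r// gt_eqF.
move <-; rewrite mulrC ler_pM2r// lerBlDr (le_trans fg)//.
by rewrite (rnormB g u) rnorm_tri.
Qed.

(** The projection does at least as well as the vector 0, which lies in every span. *)
Lemma bad_set_eq0 f n (delta : R) : rnorm f < delta -> bad_set ip ksec f n delta = set0.
Proof.
move=> fd; apply/seteqP; split=> t //; rewrite /bad_set /= leNgt => /negP; apply.
rewrite (le_lt_trans _ fd)// -[X in _ <= rnorm X]subr0; apply: (orth_proj_le hip).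
by exists (fun=> 0) => //; rewrite big1// => i _; rewrite scale0r.
Qed.

(** Ensures that the infimum defining the distance is over a nonempty set. The witness is the image
    of the zero function. As [kernel_measure P K] is a plain set function, the integral of 0 is
    computed from its definition by suprema over simple functions. *)
Lemma kernel_range0 : kernel_range P K ksec !=set0.
Proof.
exists (kernel_operator P ksec (fun=> 0)), (fun=> 0) => //; split.
  move=> U _; have [U0|U0] := pselect (U 0).
    rewrite [X in measurable X](_ : _ = setT)//.
    by apply/seteqP; split.
  rewrite [X in measurable X](_ : _ = set0)//.
  by apply/seteqP; split.
have sint0 (h : {nnsfun X >-> R}) : (forall x, h x = 0) ->
    sintegral (kernel_measure P K) h = 0%E.
  move=> h0; rewrite /sintegral fsbig1// => r _.
  (* The value 0 contributes nothing whatever its weight; any other value has an empty preimage. *)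
  have [->|r0] := eqVneq r 0; first by rewrite mul0e.
  rewrite (_ : _ @^-1` _ = set0) ?/kernel_measure ?integral_set0 ?mule0//.
  by apply/seteqP; split=> x //= hr; rewrite -hr h0 eqxx in r0.
have sup0 (phi : X -> \bar R) : (forall x, phi x = 0%E) ->
    ereal_sup [set sintegral (kernel_measure P K) h |
      h in [set h : {nnsfun X >-> R} | forall x, ((h x)%:E <= phi x)%E]] = 0%E.
  move=> phi0; apply/eqP; rewrite eq_le; apply/andP; split; last first.
    by apply: ereal_sup_ubound; exists nnsfun0 => [x|]; rewrite ?phi0 ?sint0.
  apply/ge_ereal_sup => _ [h /= hphi <-]; rewrite sint0// => x.
  apply/eqP; rewrite eq_le; apply/andP; split; last exact: fun_ge0.
  by have := hphi x; rewrite phi0 lee_fin.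
rewrite /= normr0 raddf0 expr2 mulr0 /integral patch_setT.
by rewrite !sup0 ?sube0 ?ltry// => x; rewrite ?funeposE ?funenegE ?oppe0 maxxx.
Qed.

(* If the Bochner integral defining g does not exist then g is the default
   value 0, and the bad sets are empty. *)
Lemma cvg_prob_bad_set f g (delta : R) :
  kernel_range P K ksec g -> rnorm (f - g) < delta ->
  prob_power P n (bad_set ip ksec f n delta) @[n --> \oo] --> 0%E.
Proof.
move=> [l [ml _] <-]; rewrite /kernel_operator /bochner_integral.
set h := (fun x => l x *: ksec x); set u := xget 0 _ => fg.
have [[v hv]|no_int] := pselect (exists v, is_bochner_integral P h v); last first.
  have u0 : u = 0 by apply: xgetPN => v hv; apply: no_int; exists v.
  rewrite u0 subr0 in fg; under eq_fun do rewrite bad_set_eq0// measure0.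
  exact: cvg_cst.
have hu : is_bochner_integral P h u by exact: (xgetPex 0 (ex_intro _ v hv)).
have mh : weakly_measurable ip h.
  by apply: weakly_measurableZ => //; exact: borel_scalar_measurable.
have e0 : 0 < delta - rnorm (f - u) by rewrite subr_gt0.
have := bochner_weak_law hip hsep mh hu e0.
apply: (@squeeze_cvge _ _ _ _ (cst 0%E)); last exact: cvg_cst.
(* The inclusion in the deviation set is available from [n = 1] on. *)
exists 1%N => // n /= n0; rewrite measure_ge0 /= le_measure ?inE//.
- exact: measurable_bad_set.
- exact: measurable_deviation_set.
- exact: bad_set_sub_deviation_set.
Qed.

End bad_sets.

(** * The limsup bound and convergence for the closure of the range *)

Theorem theorem3p6 (R : realType) (k : field_kind)
  (d : measure_display) (X : measurableType d) (P : probability X R)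
  (H : completeNormedModType (base_field R k))
  (ip : {dot H for @sconj R k}) (hip : hilbert_product ip)
  (hsep : separable H)
  (ev : H -> X -> base_field R k) (K : X -> X -> base_field R k)
  (ksec : X -> H) (hK : reproducing_kernel ip ev K ksec)
  (mK : borel_measurable (fun z : X * X => K z.1 z.2))
  (f : H) :
  (forall (delta : R) (n : nat), 0 < delta ->
     measurable (bad_set ip ksec f n delta)) /\
  (forall delta : R, 0 < delta ->
     (limn_esup (fun n => prob_power P n (bad_set ip ksec f n delta)) <=
      ((delta ^+ 2)^-1 * dist_to f (kernel_range P K ksec) ^+ 2)%:E)%E) /\
  (closure (kernel_range P K ksec) f ->
   forall delta : R, 0 < delta ->
     prob_power P n (bad_set ip ksec f n delta) @[n --> \oo] --> 0%E).
Proof.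
have mk := weakly_measurable_ksec hip hK mK.
have mB delta n : measurable (bad_set ip ksec f n delta).
  exact: measurable_bad_set.
have cvgB g delta : kernel_range P K ksec g -> rnorm (f - g) < delta ->
    prob_power P n (bad_set ip ksec f n delta) @[n --> \oo] --> 0%E.
  exact: (cvg_prob_bad_set hip hsep mk).
split; [by []|split].
  move=> delta delta0.
  have [[g [Vg fg]]|far] := pselect (exists g, kernel_range P K ksec g /\
      rnorm (f - g) < delta).
    have [_ ->] := cvg_limn_einf_sup (cvgB _ _ Vg fg).
    by rewrite lee_fin mulr_ge0 ?invr_ge0 ?sqr_ge0.
  have dist_ge : delta <= dist_to f (kernel_range P K ksec).
    apply: lb_le_inf.
      by have [g Vg] := kernel_range0 P (K := K) (ksec := ksec); exists (rnorm (f - g)), g.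
    move=> _ [g Vg <-]; rewrite leNgt; apply/negP => fg.
    by apply: far; exists g.
  apply: (@le_trans _ _ 1%E).
    rewrite limn_esup_lim; apply: lime_le; first exact: is_cvg_esups.
    apply: nearW => n; apply: ge_ereal_sup => _ [m _ <-].
    by apply: probability_le1; exact: mB.
  rewrite lee_fin mulrC ler_pdivlMr ?exprn_gt0// mul1r.
  by apply: lerXn2r; rewrite ?nnegrE ?(ltW delta0)// (le_trans (ltW delta0)).
move=> fcl delta delta0.
have sd0 : 0 < @sreal R k delta by rewrite -(rmorph0 (@sreal R k)) sreal_lt.
(* A single [g] in the range closer to [f] than [delta] is enough, so the ball of radius [delta] is
   used directly. *)
have [g [Vg fg]] := fcl _ (nbhsx_ballx f _ sd0).
apply: (cvgB g) => //.
by move: fg; rewrite -ball_normE /= rnorm_sreal sreal_lt.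
Qed.
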